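(* Let $(\mathcal{X},\mathcal{F},\sigma)$ be a probability space with an $\alpha$-homogeneous atomic filtration $(\mathcal{F}_n)_{n\ge 0}$, $0<\alpha\le 1/2$. Let $f\in L^1(\mathcal{X})$ be such that $S(f)\in L^\infty$. Then \[ \mathbb{E}\exp\Bigl(f-\frac{S(f)^2}{4\alpha}\Bigr)\le \exp(\mathbb{E} f). \]
   Context: An atomic filtration on a probability space $(\mathcal{X},\mathcal{F},\sigma)$ is an increasing sequence of $\sigma$-algebras $\mathcal{F}_n\subset\mathcal{F}$, $n\ge0$, with $\mathcal{F}_0=\{\varnothing,\mathcal{X}\}$, $\mathcal{F}$ generated by the $\mathcal{F}_n$, and such that for each $n$ there is a countable collection $\mathcal{D}_n$ of disjoint sets (''cubes'') with every set of $\mathcal{F}_n$ a union of sets of $\mathcal{D}_n$. Write $\mathcal{D}=\bigcup_n\mathcal{D}_n$, $|A|=\sigma(A)$, and for $Q\in\mathcal{D}_n$ let $\operatorname{ch}Q=\{R\in\mathcal{D}_{n+1}:R\subset Q\}$. The filtration is $\alpha$-homogeneous ($0<\alpha\le1/2$) if $|Q'|\ge\alpha|Q|$ for every cube $Q$ and every $Q'\in\operatorname{ch}Q$. For measurable $A$ with $|A|>0$, $\langle f\rangle_A=|A|^{-1}\int_A f$ (and $\langle f\rangle_A=0$ if $|A|=0$); $\mathbb{E}f=\langle f\rangle_{\mathcal{X}}$. Let $\mathbf{E}_Q f=\langle f\rangle_Q\mathbf{1}_Q$, $\Delta_Q=\sum_{R\in\operatorname{ch}Q}\mathbf{E}_R-\mathbf{E}_Q$.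 The square function is $S f=\bigl(\sum_{Q\in\mathcal{D}}|\Delta_Q f|^2\bigr)^{1/2}$. *)

(* Defs.v *)
From HB Require Import structures.
From mathcomp Require Import all_boot all_order all_algebra.
From mathcomp Require Import all_classical all_reals all_analysis.
Set Implicit Arguments. Unset Strict Implicit. Unset Printing Implicit Defensive.
Import Order.TTheory GRing.Theory Num.Theory.
Local Open Scope classical_set_scope.
Local Open Scope ring_scope.

Section Dyadic.
Context {d : measure_display} {T : measurableType d} {R : realType}.
Variable (P : probability T R).

Definition avg (f : T -> R) (A : set T) : R :=
  if P A == 0%E then 0
  else fine (\int[P]_(x in A) (f x)%:E) / fine (P A).

Definition expect (f : T -> R) : R := avg f setT.

Definition atomic_filtration (F : nat -> set (set T)) (D : nat -> set (set T)) :=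
  [/\ (forall n, sigma_algebra setT (F n) /\ F n `<=` measurable),
      (forall n, F n `<=` F n.+1),
      F 0%N = [set set0] `|` [set setT],
      <<s (\bigcup_n F n) >> = (@measurable d T) &
      (forall n, [/\ countable (D n), D n `<=` F n,
         (forall Q, D n Q -> Q !=set0), trivIset (D n) id &
         (forall A, F n A -> exists C, C `<=` D n /\ A = \bigcup_(Q in C) Q)])].

Definition children (D : nat -> set (set T)) (n : nat) (Q : set T) : set (set T) :=
  [set Q' | D n.+1 Q' /\ Q' `<=` Q].

Definition homogeneous (D : nat -> set (set T)) (alpha : R) :=
  forall n Q Q', D n Q -> children D n Q Q' -> (alpha%:E * P Q <= P Q')%E.

Definition Delta (D : nat -> set (set T)) (n : nat) (Q : set T) (f : T -> R)
    (x : T) : R :=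
  (\sum_(Q' \in children D n Q) avg f Q' * \1_Q' x) - avg f Q * \1_Q x.

Definition cubes (D : nat -> set (set T)) : set (nat * set T) :=
  [set p | D p.1 p.2].

Definition sqfun_sq (D : nat -> set (set T)) (f : T -> R) (x : T) : \bar R :=
  (\esum_(p in cubes D) ((Delta D p.1 p.2 f x) ^+ 2)%:E)%E.

Definition sqfun (D : nat -> set (set T)) (f : T -> R) (x : T) : R :=
  Num.sqrt (fine (sqfun_sq D f x)).

End Dyadic.

(* Main.v *)
Require Import Defs.
From HB Require Import structures.
From mathcomp Require Import all_boot all_order all_algebra.
From mathcomp Require Import all_classical all_reals all_analysis.
From mathcomp Require Import finmap measurable_realfun ring lra.
Import Order.TTheory GRing.Theory Num.Theory.
Import numFieldNormedType.Exports.
Local Open Scope classical_set_scope.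
Local Open Scope ring_scope.

(** Write [f_n] for the average of [f] over the generation-[n] cubes, [S_n^2] for
    the sum of [(f_(k+1) - f_k)^2] over [k < n], and
    [g x = exp (x - x^2 / (4 alpha))].  On a cube [Q] the increment
    [X = f_(n+1) - f_n] has mean zero and takes its minimum [-t] on a child of
    relative mass at least [alpha].  The tangent to [g] at
    [y = min (alpha t / (1 - alpha), 2 alpha)] majorizes [g] on [[-t, +oo[], so
    bounding [g X] by it off that child reduces [E_Q (g X) <= 1] to the two-point
    distribution with mass [alpha] at [-t] and [1 - alpha] at [y]; monotonicity
    in [1 / alpha] reduces that case to [cosh u <= exp (u^2 / 2)].  Hence
    [exp (f_n - S_n^2 / (4 alpha))] is a supermartingale started at [exp (E f)].
    Finally [f_n] tends to [f] in [L^1], and a simple function [h] bounded by [C]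
    and by [exp (f - S^2 / (4 alpha))] is at most
    [exp (f_n - S_n^2 / (4 alpha)) + C |f - f_n|], so that no almost sure
    convergence is needed. *)

(** * Real inequalities *)

Section RealInequalities.
Context {R : realType}.
Implicit Types x : R.

Lemma le_of_derive (F F' : R -> R) (a b : R) : a <= b ->
  (forall x, a <= x <= b -> is_derive x 1 F (F' x)) ->
  (forall x, a <= x <= b -> 0 <= F' x) -> F a <= F b.
Proof.
move=> ab dF F'0.
have cF : {within `[a, b], continuous F}.
  by apply: derivable_within_continuous => x; rewrite in_itv /= => /dF[].
have [|c] := @MVT_segment R F F' a b ab _ cF.
  by move=> x /subset_itv_oo_cc; rewrite in_itv /= => /dF.
rewrite in_itv /= => cab E; rewrite -subr_ge0 E mulr_ge0 ?subr_ge0 //.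
exact: F'0.
Qed.

Lemma is_derive_divr (a y : R) : y != 0 ->
  is_derive y 1 (fun k : R => a / k) (- (a / y ^+ 2)).
Proof.
move=> y0.
have dV : is_derive y 1 (fun k : R => k^-1) (- y ^- 2 *: 1).
  apply: DeriveDef; first exact: derivableV.
  by rewrite deriveV // derive_id.
by apply: is_derive_eq; rewrite /GRing.scale /=; field.
Qed.

(** Taylor bounds are integrated one from another: the difference of the two sides vanishes at 0,
    and its derivative is nonnegative by the preceding bound, here [expR_ge1Dx]. *)
Lemma expRN_le2 x : 0 <= x -> expR (- x) <= 1 - x + x ^+ 2 / 2.
Proof.
move=> x0.
pose F := (fun y : R => 1 - y + y ^+ 2 / 2 - expR (- y)).
suff: F 0 <= F x.
  by rewrite /F /= oppr0 expR0; lra.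
apply: (@le_of_derive F (fun y => y - 1 + expR (- y))) => // y y0.
  by apply: is_derive_eq; rewrite /GRing.scale /=; field.
by have := expR_ge1Dx (- y); lra.
Qed.

Lemma expRN_ge3 x : 0 <= x -> 1 - x + x ^+ 2 / 2 - x ^+ 3 / 6 <= expR (- x).
Proof.
move=> x0.
pose F := (fun y : R => expR (- y) - (1 - y + y ^+ 2 / 2 - y ^+ 3 / 6)).
suff: F 0 <= F x.
  by rewrite /F /= oppr0 expR0; lra.
apply: (@le_of_derive F (fun y => 1 - y + y ^+ 2 / 2 - expR (- y))) => // y.
  by move=> _; apply: is_derive_eq; rewrite /GRing.scale /=; field.
by move=> /andP[y0 _]; have := expRN_le2 _ y0; lra.
Qed.

(** Serves [two_point_bound], for the part of the derivative in [k] without the factor [s ^+ 2]. *)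
Lemma one_sub_expRN_le x : 0 <= x -> 1 - (1 + x) * expR (- x) <= x ^+ 2 / 2.
Proof.
move=> x0.
pose F := (fun y : R => y ^+ 2 / 2 + (1 + y) * expR (- y)).
suff: F 0 <= F x.
  by rewrite /F /= oppr0 expR0; lra.
apply: (@le_of_derive F (fun y => y * (1 - expR (- y)))) => // y.
  by move=> _; apply: is_derive_eq; rewrite /GRing.scale /=; field.
move=> /andP[y0 _]; rewrite mulr_ge0 // subr_ge0 -[leRHS]expR0 ler_expR.
by rewrite oppr_le0.
Qed.

Lemma cosh_le_expR_sqr x : 0 <= x -> expR x + expR (- x) <= 2 * expR (x ^+ 2 / 2).
Proof.
move=> x0.
(* This is sinh y <= y cosh y, which gives the sign of the derivative of cosh y / exp (y^2 / 2). *)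
have K (y : R) : 0 <= y -> (1 - y) * expR y <= (1 + y) * expR (- y).
  move=> y0.
  pose G := (fun y : R => (1 + y) * expR (- y) - (1 - y) * expR y).
suff: G 0 <= G y.
    by rewrite /G /= oppr0 expR0; lra.
  apply: (@le_of_derive G (fun y => y * (expR y - expR (- y)))) => // z.
    by move=> _; apply: is_derive_eq; rewrite /GRing.scale /=; field.
  by move=> /andP[z0 _]; rewrite mulr_ge0 // subr_ge0 ler_expR; lra.
pose F := (fun y : R => - (expR (- (y ^+ 2 / 2)) * (expR y + expR (- y)))).
suff: F 0 <= F x.
  rewrite /F /= expr0n /= mul0r oppr0 expR0 lerN2 expRN.
  by rewrite ler_pdivrMl ?expR_gt0 //; lra.
apply: (@le_of_derive F (fun y => expR (- (y ^+ 2 / 2)) *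
   ((1 + y) * expR (- y) - (1 - y) * expR y))) => // z.
  by move=> _; apply: is_derive_eq; rewrite /GRing.scale /=; field.
by move=> /andP[z0 _]; rewrite mulr_ge0 ?expR_ge0 // subr_ge0 K.
Qed.

(** Puts g below its tangent at y: here h is x - y, a is the logarithmic derivative of g at y, g y
    is divided out, and 4 alpha <= 2 is used on the quadratic term. For a > 0, the bound on h keeps
    it where [F] is minimal at 0. *)
Lemma tangent_bound (a h : R) : 0 <= a <= 1 -> (a = 0 \/ - (2 * (1 - a)) <= h) ->
  expR (a * h - h ^+ 2 / 2) <= 1 + a * h.
Proof.
move=> /andP[a0 a1] [->|ha].
  by rewrite !mul0r addr0 -[leRHS]expR0 ler_expR; have := sqr_ge0 h; lra.
pose F (h : R) := (1 + a * h) * expR (h ^+ 2 / 2 - a * h).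
pose F' (h : R) := h * (1 + a * h - a ^+ 2) * expR (h ^+ 2 / 2 - a * h).
have dF (y : R) : is_derive y 1 F (F' y).
  by rewrite /F /F'; apply: is_derive_eq; rewrite /GRing.scale /=; field.
suff : F 0 <= F h.
  rewrite /F mulr0 addr0 expr0n /= mul0r subr0 expR0 mulr1.
  rewrite -[h ^+ 2 / 2 - a * h]opprB expRN ler_pdivlMr ?expR_gt0 //.
  by rewrite mul1r.
case: (lerP 0 h) => h0.
  apply: (@le_of_derive F F') => // y /andP[y0 yh].
  rewrite /F' mulr_ge0 ?expR_ge0 // mulr_ge0 //.
  have := mulr_ge0 a0 y0; have := exprn_ile1 2 a0 a1. lra.
rewrite -lerN2; apply: (@le_of_derive (fun y => - F y) (fun y => - F' y)).
- exact: ltW.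
- move=> y /andP[yh y0]; rewrite oppr_ge0 /F' mulr_le0_ge0 ?expR_ge0 //.
  rewrite mulr_le0_ge0 //.
  (* The threshold gives [1 + a * y - a ^+ 2 >= (1 - a) ^+ 2]. *)
  have := ler_wpM2l a0 (le_trans ha yh); have := sqr_ge0 (1 - a); nra.
Qed.

(* Multiplying by [expR (k * s ^+ 2)] makes the left side independent of [k] and
   the right side nondecreasing in [k]; at [k = 2] this is [cosh_le_expR_sqr]. *)
Lemma two_point_bound (s k : R) : 0 <= s <= 1 -> 2 <= k ->
  expR (- (2 * s * (1 - s) + k * s ^+ 2)) <=
  1 - k + k * expR (- (s * (2 - s) / k)).
Proof.
move=> /andP[s0 s1] k2; set a := s * (2 - s).
have a0 : 0 <= a by rewrite mulr_ge0; lra.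
pose F := (fun k => (1 - k + k * expR (- (a / k))) * expR (k * s ^+ 2)) : R -> R.
pose F' := (fun k => (-1 + (1 + a / k) * expR (- (a / k)) +
   s ^+ 2 * (1 - k + k * expR (- (a / k)))) * expR (k * s ^+ 2)) : R -> R.
have base : expR (- (2 * s - 2 * s ^+ 2)) <= F 2.
  have := @cosh_le_expR_sqr s s0.
  rewrite /F (_ : 1 - 2 + 2 * expR (- (a / 2)) = expR (- (2 * s)) + (2 * expR (-(a / 2)) - 1 - expR (- (2 * s)))); last by ring.
  move=> C.
  have -> : - (2 * s - 2 * s ^+ 2) = - (2 * s) + 2 * s ^+ 2 by ring.
  rewrite expRD ler_pM2r ?expR_gt0 // lerDl.
  (* Multiplication by [expR s] turns the exponents into [s ^+ 2 / 2], [s] and [- s], as in the cosh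
     inequality. *)
  rewrite -(pmulr_rge0 _ (expR_gt0 s)).
  have -> : expR s * (2 * expR (- (a / 2)) - 1 - expR (- (2 * s))) =
     2 * expR (s - a / 2) - expR s - expR (s - 2 * s).
    by rewrite !expRD; ring.
  have -> : s - a / 2 = s ^+ 2 / 2 by rewrite /a; field.
  by have -> : s - 2 * s = - s; [ring | lra].
have : F 2 <= F k.
  have dF (y : R) : 2 <= y <= k -> is_derive y 1 F (F' y).
    move=> /andP[y2 _]; have y0 : y != 0 by rewrite gt_eqF //; lra.
    have dG (q : R -> R) (dq : R) : is_derive y 1 q dq ->
      is_derive y 1 (fun k => (1 - k + k * expR (- q k)) * expR (k * s ^+ 2))
        ((-1 + expR (- q y) - y * dq * expR (- q y) +
         s ^+ 2 * (1 - y + y * expR (- q y))) * expR (y * s ^+ 2)).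
      by move=> dq'; apply: is_derive_eq; rewrite /GRing.scale /=; ring.
    apply: (@is_derive_eq _ _ _ _ _ _ _ _ (dG _ _ (is_derive_divr a _ y0))).
    by rewrite /F'; field.
  apply: (@le_of_derive F F' 2 k k2 dF) => y /andP[y2 yk].
  rewrite /F' mulr_ge0 ?expR_ge0 //.
  have y0 : 0 < y by lra.
  set x := a / y.
  have x0 : 0 <= x by rewrite divr_ge0 // ltW.
  have ay : a = y * x by rewrite /x; field; lra.
  have h1 := one_sub_expRN_le _ x0.
  have h2 := expRN_ge3 _ x0.
  have h3 : 1 - a + a * x / 2 - a * x ^+ 2 / 6 <= 1 - y + y * expR (- x).
    rewrite ay; move: h2; rewrite -(ler_pM2l y0); lra.
  have h4 : s ^+ 2 * (1 - a + a * x / 2 - a * x ^+ 2 / 6) <=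
     s ^+ 2 * (1 - y + y * expR (- x)) by rewrite ler_wpM2l // sqr_ge0.
  suff : 0 <= s ^+ 2 * (1 - a + a * x / 2 - a * x ^+ 2 / 6) - x ^+ 2 / 2 by lra.
  have x2 : x <= a / 2 by rewrite ay; nra.
  have xs : x <= s * (2 - s) / 2 by [].
  (* For s > 0, r is 2 / y. Since 1 - a = (1 - s)^2 and a = s (2 - s), the factor [s ^+ 2] can then
     be pulled out. *)
  have [r [r0 r1 xr]] : exists r, [/\ 0 <= r, r <= 1 & x = r * a / 2].
    have [s00|sn0] := eqVneq s 0.
      by exists 0; split => //; move: x0 x2; rewrite /a s00; lra.
    have a_gt0 : 0 < a by rewrite mulr_gt0 //; lra.
    exists (2 * x / a); split; first by rewrite divr_ge0 //; lra.
      by rewrite ler_pdivrMr // mul1r; lra.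
    by field; rewrite gt_eqF.
  have -> : s ^+ 2 * (1 - a + a * x / 2 - a * x ^+ 2 / 6) - x ^+ 2 / 2 =
    s ^+ 2 * ((1 - s) ^+ 2 + r * a ^+ 2 / 4 -
              r ^+ 2 * (a ^+ 3 / 24 + (2 - s) ^+ 2 / 8)).
    by rewrite xr /a; field.
  rewrite mulr_ge0 ?sqr_ge0 //.
  have a1 : a <= 1 by rewrite /a; have := sqr_ge0 (1 - s); lra.
  have a3 : a ^+ 3 <= a ^+ 2 by rewrite exprS ler_piMl ?sqr_ge0.
  (* With r^2 <= r and a^3 <= a^2 the lower bound becomes affine in r, so only r = 0 and r = 1
     matter. *)
  have rr : r ^+ 2 * (a ^+ 3 / 24 + (2 - s) ^+ 2 / 8) <=
            r * (a ^+ 2 / 24 + (2 - s) ^+ 2 / 8).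
    apply: ler_pM; rewrite ?sqr_ge0 //; last by lra.
      by have := exprn_ge0 3 a0; have := sqr_ge0 (2 - s); lra.
    by rewrite expr2 ler_piMl.
  (* In u = 1 - s this is 5/24 u^4 + 11/24 u^2 - u/4 + 1/12; the square is completed at u = 3/11. *)
  have q : 0 <= (1 - s) ^+ 2 + 5 / 24 * a ^+ 2 - (2 - s) ^+ 2 / 8.
    have := sqr_ge0 ((1 - s) ^+ 2); have := sqr_ge0 (1 - s - 3 / 11).
    by rewrite /a; lra.
  have := mulr_ge0 r0 q; have := @mulr_ge0 _ (1 - r) _ _ (sqr_ge0 (1 - s)).
  by lra.
move=> h; have := le_trans base h; rewrite /F.
have -> : - (2 * s * (1 - s) + k * s ^+ 2) = - (2 * s - 2 * s ^+ 2) - k * s ^+ 2 by ring.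
by rewrite expRD [expR (- (k * s ^+ 2))]expRN ler_pdivrMr ?expR_gt0.
Qed.

(* Integrating the affine bound against a mean-zero law with an atom of mass
   [p >= alpha] at its minimum [- t] gives
   [mu - p * (mu - lambda * t - g (- t))], which is largest at [p = alpha]. *)
Lemma dual_certificate (alpha t : R) : 0 < alpha -> alpha <= 2^-1 -> 0 <= t ->
  let g := fun x : R => expR (x - x ^+ 2 / (4 * alpha)) in
  exists mu lambda : R,
    (forall x, - t <= x -> g x <= mu + lambda * x) /\
    mu - alpha * (mu - lambda * t - g (- t)) <= 1.
Proof.
move=> al0 al2 t0 g.
(* The tangent point is alpha s. Below the cap, the law with mass alpha at - t and 1 - alpha at
   alpha s has mean zero; the cap 2 keeps the slope nonnegative. *)
pose s := Num.min (t / (1 - alpha)) 2.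
have b0 : 0 < 1 - alpha by lra.
have s0 : 0 <= s by rewrite /s le_min divr_ge0 //= ltW.
have s2 : s <= 2 by rewrite /s ge_min lexx orbT.
have st : (1 - alpha) * s <= t.
  by rewrite mulrC -ler_pdivlMr // /s ge_min lexx.
have sE : s = 2 \/ (1 - alpha) * s = t.
  rewrite /s; case: leP => _; last by left.
  by right; field; rewrite gt_eqF.
pose a := 1 - s / 2.
have a01 : 0 <= a <= 1 by apply/andP; rewrite /a; split; lra.
pose y := alpha * s.
exists (g y * (1 - a * y)), (g y * a); split.
  move=> x xt.
  have -> : g y * (1 - a * y) + g y * a * x = g y * (1 + a * (x - y)) by ring.
  have -> : g x = g y * expR (a * (x - y) - (x - y) ^+ 2 / (4 * alpha)).
    rewrite /g -expRD; congr expR; rewrite /y /a; field.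
    by rewrite gt_eqF.
  rewrite ler_pM2l ?expR_gt0 //.
  (* Below the cap, x >= - t gives x - y >= - (1 - alpha) s - alpha s = - s, which is the threshold
     - 2 (1 - a); at the cap, a = 0. *)
  apply: (le_trans _ (tangent_bound _ _ a01 _)).
    rewrite ler_expR lerD2l lerN2 ler_wpM2l ?sqr_ge0 // lef_pV2 ?posrE; lra.
  case: sE => sE; first by left; rewrite /a sE; lra.
  by right; rewrite /a /y; move: xt; rewrite -sE; lra.
(* Since t >= (1 - alpha) s, [g (- t)] is at most g at - (1 - alpha) s, which is the right side. *)
have gt : g (- t) <= expR (alpha * s - alpha * s ^+ 2 / 4) *
   expR (- (2 * (s / 2) * (1 - s / 2) + alpha^-1 * (s / 2) ^+ 2)).
  rewrite /g -expRD ler_expR.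
  have -> : alpha * s - alpha * s ^+ 2 / 4 -
    (2 * (s / 2) * (1 - s / 2) + alpha^-1 * (s / 2) ^+ 2) =
    - ((1 - alpha) * s) - ((1 - alpha) * s) ^+ 2 / (4 * alpha).
    by field; rewrite gt_eqF.
  apply: lerD; first by rewrite lerN2.
  rewrite lerN2 sqrrN; apply: ler_wpM2r.
    by rewrite invr_ge0 mulr_ge0 // ltW.
  by apply: lerXn2r; rewrite ?nnegrE // mulr_ge0 // ltW.
have s201 : 0 <= s / 2 <= 1 by apply/andP; split; lra.
have k2 : 2 <= alpha^-1 by rewrite -[2]invrK lef_pV2 ?posrE // invr_gt0.
have gy : g y = expR (alpha * s - alpha * s ^+ 2 / 4).
  by rewrite /g /y; congr expR; field; rewrite gt_eqF.
have /(ler_wpM2l (expR_ge0 (alpha * s - alpha * s ^+ 2 / 4))) :=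
  two_point_bound _ _ s201 k2.
rewrite -gy => tp.
(* The last exponent is exactly minus the logarithm of [g y]. *)
have tpE : g y * (1 - alpha^-1 +
    alpha^-1 * expR (- (s / 2 * (2 - s / 2) / alpha^-1))) =
    g y * (1 - alpha^-1) + alpha^-1.
  rewrite mulrDr mulrCA gy -expRD.
  have -> : alpha * s - alpha * s ^+ 2 / 4 - s / 2 * (2 - s / 2) / alpha^-1 = 0.
    by field; rewrite gt_eqF.
  by rewrite expR0 mulr1.
rewrite tpE in tp.
rewrite -gy in gt.
have {tp gt} gt := le_trans gt tp.
have : alpha * g (- t) <= g y * (alpha - 1) + 1.
  apply: (le_trans (ler_wpM2l (ltW al0) gt)); rewrite le_eqVlt; apply/orP; left.
  by apply/eqP; field; rewrite gt_eqF.
(* The linear terms cancel: either the two-point law is centred, or the cap is reached and a = 0. *)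
suff : (1 - alpha) * (a * y) = alpha * (a * t).
  move=> E.
  have -> : g y * (1 - a * y) - alpha * (g y * (1 - a * y) - g y * a * t - g (- t))
   = (1 - alpha) * g y + g y * (alpha * (a * t) - (1 - alpha) * (a * y)) + alpha * g (- t) by ring.
  by rewrite E; lra.
case: sE => sE; last by rewrite /y -sE; ring.
by have -> : a = 0; [rewrite /a sE; lra|lra].
Qed.

End RealInequalities.

(** * Integrals over finite disjoint unions *)

Lemma integral_bigcup_finite (d : measure_display) (T : measurableType d)
    (R : realType) (mu : {measure set T -> \bar R}) (C : set (set T)) (f : T -> R) :
  finite_set C -> C `<=` measurable -> trivIset C id ->
  measurable_fun (\bigcup_(A in C) A) f ->
  (\int[mu]_(x in \bigcup_(A in C) A) (f x)%:E =
   \sum_(A <- fset_set C) \int[mu]_(x in A) (f x)%:E)%E.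
Proof.
move=> fC mC tC mf.
(* Indices off [C] are sent to the empty set, so that [G A] is measurable for every [A]. *)
pose G (A : set T) := if A \in C then A else set0.
have GE A : C A -> G A = A by rewrite /G => /mem_set ->.
have UE : \bigcup_(A in C) A = \big[setU/set0]_(A <- fset_set C) G A.
  by rewrite bigsetU_fset_set //; apply: eq_bigcupr => A /GE ->.
rewrite UE integral_bigsetU_EFin //.
- rewrite big_seq [RHS]big_seq; apply: eq_bigr => A.
  by rewrite in_fset_set // => /set_mem /GE ->.
- move=> A; rewrite /G; case: ifPn => // /set_mem; exact: mC.
- by rewrite fset_setK // => A B CA CB; rewrite !GE //; exact: tC.
- by rewrite -UE; exact/measurable_EFinP.
Qed.

(** * Atomic filtrations *)

Section Filtration.
Context {d : measure_display} {T : measurableType d} {R : realType}.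
Variables (P : probability T R) (F : nat -> set (set T)) (D : nat -> set (set T)).
Variable alpha : R.
Hypotheses (HF : atomic_filtration F D) (al0 : 0 < alpha).
Hypothesis Hh : homogeneous P D alpha.

(* The generation-[n] cube containing [x], described without choice. *)
Definition cube n x := [set y | exists Q, [/\ D n Q, Q x & Q y]].

Lemma cube_measurable n Q : D n Q -> measurable Q.
Proof.
by case: HF => FM _ _ _ HD /(let: And5 _ h _ _ _ := HD n in h); case: (FM n) => _; apply.
Qed.

Lemma cube_unique n Q Q' x : D n Q -> D n Q' -> Q x -> Q' x -> Q = Q'.
Proof.
case: HF => _ _ _ _ /(_ n)[_ _ _ tD _] DQ DQ' Qx Q'x.
by apply: tD => //; exists x.
Qed.

Lemma cubeE n Q x : D n Q -> Q x -> cube n x = Q.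
Proof.
move=> DQ Qx; apply/seteqP; split => y /=; last by exists Q.
by case=> Q' [DQ' Q'x]; rewrite (cube_unique n Q Q' x).
Qed.

Lemma cube_cover n x : exists2 Q, D n Q & Q x.
Proof.
case: HF => FM _ _ _ /(_ n)[_ _ _ _]; case: (FM n) => [[F0 FC _] _].
move=> /(_ setT)[|C [CD E]]; first by rewrite -(setD0 setT); exact: FC.
have : [set: T] x by []. rewrite E => -[Q CQ Qx]; exists Q => //; exact: CD.
Qed.

Lemma D_cube n x : D n (cube n x).
Proof. by have [Q DQ Qx] := cube_cover n x; rewrite (cubeE n Q). Qed.

Lemma cube_refl n x : cube n x x.
Proof. by have [Q DQ Qx] := cube_cover n x; exists Q. Qed.

Lemma cube_eq n x y : cube n x y -> cube n y = cube n x.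
Proof. by move=> xy; apply: cubeE => //; exact: D_cube. Qed.

(** A cube of generation n belongs to [F n.+1], hence is a union of finer cubes, one of which
    contains [x]. *)
Lemma cubeS n x : cube n.+1 x `<=` cube n x.
Proof.
case: HF => _ FS _ _ HD.
have : F n.+1 (cube n x).
  by apply: FS; have [_ + _ _ _] := HD n; apply; exact: D_cube.
have [_ _ _ _ /[apply]] := HD n.+1 => -[C [CD E]].
have := cube_refl n x; rewrite E => -[Q CQ Qx] y.
by rewrite (cubeE n.+1 Q) //; [exists Q|exact: CD].
Qed.

Lemma cube_subset m n x : (m <= n)%N -> cube n x `<=` cube m x.
Proof.
move=> /subnK <-; elim: (n - m)%N => // k IH.
by apply: subset_trans IH; exact: cubeS.
Qed.

Lemma cube0 x : cube 0 x = setT.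
Proof.
case: HF => _ _ F0 _ /(_ 0%N)[_ + _ _ _] => /(_ _ (D_cube 0 x)).
rewrite F0 => -[] //= E; by have := cube_refl 0 x; rewrite E.
Qed.

Lemma D_children n Q x : D n Q -> Q x -> children D n Q (cube n.+1 x).
Proof.
move=> DQ Qx; split; first exact: D_cube.
by rewrite -(cubeE n Q x) //; exact: cubeS.
Qed.

Lemma D_inhabited n Q : D n Q -> exists x, Q x.
Proof. by case: HF => _ _ _ _ /(_ n)[_ _ + _ _] => /[apply]. Qed.

(** * Mass and number of cubes *)

Lemma P_cube_ge n Q : D n Q -> ((alpha ^+ n)%:E <= P Q)%E.
Proof.
move=> DQ; have [x Qx] := D_inhabited n Q DQ.
rewrite -(cubeE n Q x) // {DQ Qx Q}.
elim: n => [|n IH]; first by rewrite cube0 probability_setT expr0.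
apply: le_trans (Hh n (cube n x) (cube n.+1 x) _ _).
- by rewrite exprS EFinM lee_pmul2l // lte_fin.
- exact: D_cube.
- by apply: D_children; [exact: D_cube | exact: cube_refl].
Qed.

Lemma P_cube_gt0 n Q : D n Q -> (0 < P Q)%E.
Proof.
by move=> /P_cube_ge; apply: lt_le_trans; rewrite lte_fin exprn_gt0.
Qed.

Lemma D_trivIset n : trivIset (D n) id.
Proof. by case: HF => _ _ _ _ /(_ n)[]. Qed.

(** Disjoint cubes of mass at least alpha^n number at most alpha^-n. Sums over cubes are therefore
    finite. *)
Lemma D_finite n : finite_set (D n).
Proof.
apply: contrapT => /infinite_set_fset.
have [N Na] : exists N : nat, alpha ^- n < N%:R.
  by exists (Num.truncn (alpha ^- n)).+1; exact: truncnS_gt.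
move=> /(_ N)[B BD NB].
have mB Q : Q \in B -> measurable Q by move=> QB; exact: (cube_measurable n _ (BD _ QB)).
have tB : trivIset [set` B] id by apply: sub_trivIset (D_trivIset n).
have := measure_fbigsetU P mB tB.
have : (P (\big[setU/set0]_(i <- B) i) <= 1)%E.
  apply: probability_le1. rewrite big_seq. exact: bigsetU_measurable.
move=> + E; rewrite E.
apply/negP; rewrite -ltNge.
apply: (@lt_le_trans _ _ (\sum_(i <- B) (alpha ^+ n)%:E)%E).
  rewrite sumEFin lte_fin big_const_seq count_predT iter_addr_0.
  rewrite -mulr_natr -ltr_pdivrMl ?exprn_gt0 // mulr1.
  by apply: (lt_le_trans Na); rewrite ler_nat.
by rewrite big_seq [leRHS]big_seq; apply: lee_sum => Q /BD /P_cube_ge.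
Qed.

(** * Functions constant on the cubes of a generation *)

Definition cubewise n (h : T -> R) := forall x y, cube n x y -> h x = h y.

Lemma cubewise_le m n h : (m <= n)%N -> cubewise m h -> cubewise n h.
Proof. by move=> mn hm x y xy; apply: hm; apply: cube_subset xy. Qed.

Lemma cubewise_measurable n h : cubewise n h -> measurable_fun setT h.
Proof.
move=> hn _ B mB; rewrite setTI.
have -> : h @^-1` B = \bigcup_(Q in [set Q | D n Q /\ Q `<=` h @^-1` B]) Q.
  apply/seteqP; split => x /=.
    move=> Bx; exists (cube n x); last exact: cube_refl.
    by split => [|y xy /=]; [exact: D_cube|rewrite -(hn x y)].
  by case=> Q [_ QB] /QB.
apply: fin_bigcup_measurable.
  by apply: sub_finite_set (D_finite n) => Q [].
by move=> Q [/cube_measurable].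
Qed.

(** Finitely many cubes leave finitely many values. This provides the child on which an increment is
    smallest. *)
Lemma cubewise_argmin n h (A : set T) : A !=set0 -> cubewise n h ->
  exists2 x, A x & forall y, A y -> h x <= h y.
Proof.
move=> [x0 Ax0] hn.
have fh : finite_set (h @` A).
  apply: (@sub_finite_set _ _ ((fun Q => h (xget x0 Q)) @` D n)).
    move=> _ [x Ax <-]; exists (cube n x); first exact: D_cube.
    by apply/esym/hn; exact: (xgetI x0 (cube_refl n x)).
  by apply: finite_image; exact: D_finite.
have key (s : seq R) : s != [::] -> exists2 m, m \in s & {in s, forall y, m <= y}.
  elim: s => // a [|b s] IH _.
    by exists a; rewrite ?inE // => y; rewrite inE => /eqP ->.
  have [//|m ms mmin] := IH; exists (Num.min a m).
    by rewrite minEle; case: ifP; rewrite inE ?eqxx ?ms ?orbT.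
  move=> y; rewrite inE => /predU1P[->|/mmin ym]; rewrite ge_min ?lexx //.
  by rewrite ym orbT.
have [|m] := key (fset_set (h @` A)).
  apply/eqP => s0; have : h x0 \in fset_set (h @` A).
    by rewrite in_fset_set //; apply: mem_set; exists x0.
  by rewrite -[_ \in _]/(_ \in (fset_set _ : seq _)) s0.
rewrite in_fset_set // => /set_mem[x Ax <-] hmin.
by exists x => // y Ay; apply: hmin; rewrite in_fset_set //; apply: mem_set; exists y.
Qed.

Lemma cubewise_comp n (g : R -> R) h : cubewise n h -> cubewise n (g \o h).
Proof. by move=> hn x y xy /=; rewrite (hn x y). Qed.

Lemma cubewise_comp2 n (g : R -> R -> R) h1 h2 : cubewise n h1 -> cubewise n h2 ->
  cubewise n (fun x => g (h1 x) (h2 x)).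
Proof. by move=> hn1 hn2 x y xy /=; rewrite (hn1 x y) // (hn2 x y). Qed.

Lemma cubewise_integrable n h (A : set T) : measurable A -> cubewise n h ->
  P.-integrable A (EFin \o h).
Proof.
move=> mA hn; apply: (integrableS measurableT) => //.
have [M hM] : exists M, forall x, `|h x| <= M.
  case: (pselect ([set: T] !=set0)) => [T0|T0]; last first.
    by exists 0 => x; exfalso; apply: T0; exists x.
  (* A maximum of [|h|] is a minimum of [- |h|]. *)
  have [x _ xm] := cubewise_argmin n _ _ T0 (cubewise_comp n (fun r => - `|r|) _ hn).
  by exists `|h x| => y; rewrite -lerN2; exact: xm.
apply: (@le_integrable _ _ _ _ _ _ _ (EFin \o cst M)) => //.
- by apply/measurable_EFinP; exact: cubewise_measurable hn.
- move=> x _ /=; rewrite lee_fin (le_trans (hM x)) // ler_norm //.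
- exact: finite_measure_integrable_cst.
Qed.

Lemma setT_bigcup_cubes n : [set: T] = \bigcup_(Q in D n) Q.
Proof.
apply/seteqP; split => // x _; exists (cube n x); first exact: D_cube.
exact: cube_refl.
Qed.

Lemma le_integral_cubes n (u v : T -> R) :
  measurable_fun setT u -> measurable_fun setT v ->
  (forall Q, D n Q ->
     (\int[P]_(x in Q) (u x)%:E <= \int[P]_(x in Q) (v x)%:E)%E) ->
  (\int[P]_x (u x)%:E <= \int[P]_x (v x)%:E)%E.
Proof.
move=> mu mv uv; rewrite (setT_bigcup_cubes n).
rewrite !integral_bigcup_finite; first 1 last.
- exact: D_finite.
- by move=> Q /cube_measurable.
- exact: D_trivIset.
- by rewrite -setT_bigcup_cubes.
- exact: D_finite.
- by move=> Q /cube_measurable.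
- exact: D_trivIset.
- by rewrite -setT_bigcup_cubes.
rewrite big_seq [leRHS]big_seq; apply: lee_sum => Q.
rewrite in_fset_set; last exact: D_finite.
by move=> /set_mem; exact: uv.
Qed.

(** * Density of cubewise functions in L^1 *)

Lemma cvg0_exists_le (u : nat -> \bar R) (e : R) : u @ \oo --> 0%E -> 0 < e ->
  exists N, (u N <= e%:E)%E.
Proof.
move=> /fine_cvgP[fu /cvgrPdist_le cu] e0.
have : \forall n \near \oo, u n \is a fin_num /\ `|0 - fine (u n)| <= e.
  by near=> n; split; near: n => //; exact: cu.
move=> [N _ /(_ N (leqnn N))[fN]]; rewrite sub0r normrN => Ne.
by exists N; rewrite -(fineK fN) lee_fin (le_trans _ Ne) // ler_norm.
Unshelve. all: by end_near. Qed.

Definition approximable (h : T -> R) := forall e : R, 0 < e ->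
  exists n, exists2 k, cubewise n k & (\int[P]_x `|h x - k x|%:E <= e%:E)%E.

Lemma measurable_norm_sub (h k : T -> R) : measurable_fun setT h ->
  measurable_fun setT k -> measurable_fun setT (fun x => `|h x - k x|%:E).
Proof.
move=> mh mk; apply/measurable_EFinP; apply: measurableT_comp => //.
exact: measurable_funB.
Qed.

Lemma le_integral_norm_lip (L : R) (u h1 h2 k1 k2 : T -> R) : 0 <= L ->
  measurable_fun setT u ->
  measurable_fun setT h1 -> measurable_fun setT h2 ->
  measurable_fun setT k1 -> measurable_fun setT k2 ->
  (forall x, `|u x| <= L * (`|h1 x - k1 x| + `|h2 x - k2 x|)) ->
  (\int[P]_x `|u x|%:E <=
   L%:E * (\int[P]_x `|h1 x - k1 x|%:E + \int[P]_x `|h2 x - k2 x|%:E))%E.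
Proof.
move=> L0 mu mh1 mh2 mk1 mk2 uL.
rewrite -ge0_integralD //; [|exact: measurable_norm_sub..].
rewrite -ge0_integralZl //; last 2 first.
- by apply: emeasurable_funD; exact: measurable_norm_sub.
- by move=> x _; rewrite -EFinD lee_fin addr_ge0.
apply: ge0_le_integral => //.
- by apply/measurable_EFinP; exact: measurableT_comp.
- apply: measurable_funeM; apply: emeasurable_funD; exact: measurable_norm_sub.
- by move=> x _; rewrite -EFinD -EFinM lee_fin.
Qed.

(** Both arguments are approximated on a common finer generation. Maxima, complements and linear
    combinations are all instances. *)
Lemma approximable_comp2 (L : R) (op : R -> R -> R) (h1 h2 : T -> R) : 0 < L ->
  (forall a b c e, `|op a b - op c e| <= L * (`|a - c| + `|b - e|)) ->
  measurable_fun setT h1 -> measurable_fun setT h2 ->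
  measurable_fun setT (fun x => op (h1 x) (h2 x)) ->
  approximable h1 -> approximable h2 -> approximable (fun x => op (h1 x) (h2 x)).
Proof.
move=> L0 opL mh1 mh2 mop a1 a2 e e0.
have e' : 0 < e / (2 * L) by rewrite divr_gt0 // mulr_gt0.
have [n1 [k1 c1 i1]] := a1 _ e'; have [n2 [k2 c2 i2]] := a2 _ e'.
have c1' := cubewise_le _ _ _ (leq_maxl n1 n2) c1.
have c2' := cubewise_le _ _ _ (leq_maxr n1 n2) c2.
have c12 := cubewise_comp2 _ op _ _ c1' c2'.
exists (maxn n1 n2), (fun x => op (k1 x) (k2 x)) => //.
apply: (le_trans (@le_integral_norm_lip L _ h1 h2 k1 k2 _ _ _ _ _ _ _)) => //.
- exact: ltW.
- by apply: measurable_funB => //; exact: cubewise_measurable c12.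
- exact: cubewise_measurable c1.
- exact: cubewise_measurable c2.
apply: (@le_trans _ _ (L%:E * ((e / (2 * L))%:E + (e / (2 * L))%:E))%E).
  by rewrite lee_pmul2l //; exact: leeD.
by rewrite -EFinD -EFinM lee_fin le_eqVlt; apply/orP; left; apply/eqP; field; rewrite gt_eqF.
Qed.

Lemma approximable_close (h : T -> R) : measurable_fun setT h ->
  (forall e : R, 0 < e -> exists k, [/\ measurable_fun setT k, approximable k &
     (\int[P]_x `|h x - k x|%:E <= e%:E)%E]) -> approximable h.
Proof.
move=> mh hk e e0; have e2 : 0 < e / 2 by rewrite divr_gt0.
have [k [mk ak ik]] := hk _ e2; have [n [l cl il]] := ak _ e2.
exists n, l => //; have ml := cubewise_measurable _ _ cl.
apply: (le_trans (@le_integral_norm_lip 1 _ h k k l _ _ _ _ _ _ _)) => //.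
- exact: measurable_funB.
- by move=> x; rewrite mul1r ler_distD.
by rewrite mul1e [e]splitr EFinD; exact: leeD.
Qed.

Lemma cubewise_approximable n h : cubewise n h -> approximable h.
Proof.
move=> hn e e0; exists n, h => //.
rewrite (eq_integral (cst 0%E)) ?integral0 ?lee_fin ?ltW // => x _.
by rewrite subrr normr0.
Qed.

Lemma approximable_indicU (A B : set T) : measurable A -> measurable B ->
  approximable \1_A -> approximable \1_B -> approximable \1_(A `|` B).
Proof.
move=> mA mB aA aB.
have -> : \1_(A `|` B) = (fun x => Num.max (\1_A x) (\1_B x)) :> (T -> R).
  apply/funext => x; rewrite !indicE in_setU.
  by case: (x \in A); case: (x \in B); rewrite /= ?maxxx ?(max_idPl ler01) ?(max_idPr ler01).
apply: (@approximable_comp2 1 (fun a b => Num.max a b)) => //.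
- move=> a b c e; rewrite mul1r.
  have [h1|h1] := lerP (b - e) (a - c); have := ler_norm (a - c);
  have := ler_norm (b - e); have := ler_norm (- (a - c)); have := ler_norm (- (b - e));
  rewrite !normrN; have [] := leP a b; have [] := leP c e => *; rewrite ler_norml; apply/andP; split; lra.
- apply: measurable_maxr => //.
Qed.

(** The measurable sets with approximable indicator form a sigma-algebra containing every [F n], and
    the [F n] generate. Countable unions reduce to finite ones by continuity of [P] from above on
    the remainders. *)
Lemma approximable_indic (A : set T) : measurable A -> approximable \1_A.
Proof.
suff H : measurable `<=` [set A : set T | measurable A /\ approximable \1_A].
  by move=> /H[].
clear A; case: (HF) => FM _ _ sE HD; rewrite -[X in X `<=` _]sE.
apply: smallest_sub; last first.
  move=> A [n _ FA]; split; first by case: (FM n) => _; apply.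
  have [_ _ _ _ /(_ _ FA)[C [CD AE]]] := HD n.
  apply: (@cubewise_approximable n) => x y xy; rewrite !indicE; congr (_%:R).
  congr nat_of_bool; apply/idP/idP => /set_mem; rewrite AE => -[Q CQ Qx];
    apply/mem_set; exists Q => //.
    by rewrite -(cubeE n Q x) //; exact: CD.
  rewrite -(cubeE n Q y) //; last exact: CD.
  by rewrite (cube_eq n x y xy); exact: cube_refl.
split.
- split => //; rewrite indic0; exact: (@cubewise_approximable 0).
- move=> A [mA aA]; split; first exact: measurableD.
  have -> : \1_(setT `\` A) = (fun x => 1 - \1_A x) :> (T -> R).
    apply/funext => x; rewrite !indicE in_setD in_setT /=.
    by case: (x \in A); rewrite /= ?subrr ?subr0.
  apply: (@approximable_comp2 1 (fun a _ => 1 - a) \1_A \1_A) => //.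
    by move=> a b c e; rewrite mul1r opprB addrC addrA subrK distrC lerDl.
  by apply: measurable_funB.
move=> A mA; have mU : measurable (\bigcup_k A k).
  by apply: bigcupT_measurable => k; case: (mA k).
split => //; pose B n := \big[setU/set0]_(k < n) A k.
have mB n : measurable (B n).
  by apply: bigsetU_measurable => k _; case: (mA k).
have BU n : B n `<=` \bigcup_k A k by apply: bigsetU_bigcup.
apply: approximable_close => // e e0.
have [N PN] : exists N, (P (\bigcup_k A k `\` B N) <= e%:E)%E.
  have mUB n : measurable (\bigcup_k A k `\` B n) by exact: measurableD.
  apply: (cvg0_exists_le (fun n => P (\bigcup_k A k `\` B n))) => //.
  have I0 : \bigcap_n (\bigcup_k A k `\` B n) = set0.
    rewrite -subset0 => x Ix; have [[k _ Akx] _] := Ix 0%N I.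
    by have [_] := Ix k.+1 I; apply; rewrite /B big_ord_recr /=; right.
  have := @nonincreasing_cvg_mu _ _ _ P (fun n => \bigcup_k A k `\` B n).
  rewrite I0 measure0; apply => //.
  - by rewrite (le_lt_trans _ (ltry 1)) // probability_le1.
  - move=> m n mn; apply/subsetPset => x [Ux Bx]; split => // Bmx; apply: Bx.
    by move: x Bmx {Ux}; exact: subset_bigsetU.
exists \1_(B N); split => //.
  rewrite /B; elim: {PN} N => [|n IH].
    by rewrite big_ord0 indic0; exact: (@cubewise_approximable 0).
  have [mAn aAn] := mA n.
  by rewrite big_ord_recr /=; apply: approximable_indicU => //; exact: (mB n).
rewrite (eq_integral (fun x => (\1_(\bigcup_k A k `\` B N) x)%:E)).
  by rewrite integral_indic ?setIT //; exact: measurableD.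
move=> x _; rewrite !indicE in_setD.
case: (boolP (x \in B N)) => [/set_mem /BU /mem_set -> | _] /=; rewrite ?subrr ?normr0 //.
by rewrite andbT subr0 ger0_norm.
Qed.

Import HBSimple HBNNSimple.

(** Simple functions are dense in L^1, and each is a finite linear combination of indicators,
    treated by induction on its list of values. *)
Lemma approximable_integrable (h : T -> R) :
  P.-integrable setT (EFin \o h) -> approximable h.
Proof.
move=> ih.
have mh : measurable_fun setT h by apply/measurable_EFinP; exact: measurable_int ih.
have [g [_ _ gh]] := approximation_sfun_integrable measurableT ih.
apply: approximable_close => // e e0.
have [N hN] := cvg0_exists_le _ _ gh e0.
exists (g N); split => //.
have -> : g N = (fun x => \sum_(y <- fset_set (range (g N))) (y * \1_(g N @^-1` [set y]) x)) :> (T -> R).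
  by apply/funext => x; rewrite fimfunE fsbig_finite.
elim: (fset_set _ : seq R) => [|y s IH].
  apply: (@cubewise_approximable 0) => x z _; by rewrite !big_nil.
have mI : measurable_fun setT (\1_(g N @^-1` [set y]) : T -> R).
  exact: measurable_indic.
rewrite (_ : (fun x => _) = fun x => y * \1_(g N @^-1` [set y]) x +
  \sum_(z <- s) (z * \1_(g N @^-1` [set z]) x)); last first.
  by apply/funext => x; rewrite big_cons.
have mS : measurable_fun setT (fun x => \sum_(z <- s) (z * \1_(g N @^-1` [set z]) x)).
  apply: measurable_sum => z; apply: measurable_funM => //.
(* [|y| + 1] dominates both coefficients, [|y|] and 1, and is positive. *)
apply: (@approximable_comp2 (`|y| + 1) (fun a b => y * a + b)) => //.
- move=> a b c r; rewrite (_ : y * a + b - (y * c + r) = y * (a - c) + (b - r)); last by ring.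
  apply: (le_trans (ler_normD _ _)); rewrite normrM.
  have := mulr_ge0 (normr_ge0 y) (normr_ge0 (b - r)); have := normr_ge0 (a - c); lra.
- by apply: measurable_funD => //; exact: measurable_funM.
- exact: approximable_indic.
Qed.

(** * Averages over cubes and their increments *)

Variable f : T -> R.
Hypothesis intf : P.-integrable setT (EFin \o f).

Let intfS A : measurable A -> P.-integrable A (EFin \o f).
Proof. by move=> mA; apply: integrableS intf. Qed.

Let mf : measurable_fun setT f.
Proof. by apply/measurable_EFinP; exact: measurable_int intf. Qed.

Definition cube_avg n x := avg P f (cube n x).

Lemma cube_avg_cubewise n : cubewise n (cube_avg n).
Proof. by move=> x y xy; rewrite /cube_avg (cube_eq n x y). Qed.

(** Cubes have positive mass, so the default value of [avg] on null sets does not occur. *)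
Lemma avgM n Q : D n Q -> avg P f Q * fine (P Q) = \int[P]_(x in Q) f x.
Proof.
move=> DQ; have PQ := P_cube_gt0 n Q DQ.
rewrite /avg gt_eqF // divfK // gt_eqF // fine_gt0 // PQ /=.
by rewrite (le_lt_trans _ (ltry 1)) // probability_le1 //; exact: cube_measurable DQ.
Qed.

Lemma integral_cube_avg n Q : D n Q ->
  \int[P]_(x in Q) cube_avg n x = \int[P]_(x in Q) f x.
Proof.
move=> DQ; rewrite -(avgM n) // -Rintegral_cst; last exact: cube_measurable DQ.
by apply: eq_Rintegral => x /set_mem Qx; rewrite /cube_avg (cubeE n Q).
Qed.

(** The martingale property: [Q] is the finite disjoint union of its children, and averaging
    preserves the integral over each child. *)
Lemma integral_cube_avgS n Q : D n Q ->
  \int[P]_(x in Q) cube_avg n.+1 x = \int[P]_(x in Q) f x.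
Proof.
move=> DQ; have mQ := cube_measurable n Q DQ.
have mC Q' : children D n Q Q' -> measurable Q'.
  by case=> /cube_measurable.
have fC : finite_set (children D n Q).
  by apply: sub_finite_set (D_finite n.+1) => Q' [].
have tC : trivIset (children D n Q) id.
  by apply: sub_trivIset (D_trivIset n.+1) => Q' [].
have QE : Q = \bigcup_(Q' in children D n Q) Q'.
  apply/seteqP; split => [x Qx|x [Q' [_ Q'Q] /Q'Q//]].
  by exists (cube n.+1 x); [exact: D_children|exact: cube_refl].
rewrite /Rintegral; congr fine; rewrite {1 2}QE.
rewrite !integral_bigcup_finite //; last 2 first.
- by rewrite -QE; exact: measurable_funS mf.
- rewrite -QE; apply: (@measurable_funS _ _ _ _ setT) => //.
  exact: cubewise_measurable (cube_avg_cubewise n.+1).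
rewrite big_seq [RHS]big_seq; apply: eq_bigr => Q'.
rewrite in_fset_set // => /set_mem CQ'.
have iQ' : P.-integrable Q' (EFin \o cube_avg n.+1).
  by apply: (cubewise_integrable n.+1); [exact: mC|exact: cube_avg_cubewise].
rewrite -[LHS]fineK; last by apply: integrable_fin_num => //; exact: mC.
rewrite -[RHS]fineK; last by apply: integrable_fin_num; [exact: mC|apply: intfS; exact: mC].
by congr EFin; apply: integral_cube_avg; case: CQ'.
Qed.
Definition cube_diff n x := cube_avg n.+1 x - cube_avg n x.

Lemma cube_diff_cubewise n : cubewise n.+1 (cube_diff n).
Proof.
apply: (cubewise_comp2 n.+1 (fun a b => a - b)); first exact: cube_avg_cubewise.
by apply: (cubewise_le n) => //; exact: cube_avg_cubewise.
Qed.

Lemma integral_cube_diff n Q : D n Q -> \int[P]_(x in Q) cube_diff n x = 0.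
Proof.
move=> DQ; have mQ := cube_measurable n Q DQ.
rewrite RintegralB //; first by rewrite integral_cube_avgS // (integral_cube_avg n) // subrr.
- by apply: (cubewise_integrable n.+1) => //; exact: cube_avg_cubewise.
- by apply: (cubewise_integrable n) => //; exact: cube_avg_cubewise.
Qed.

(** * The one-step exponential estimate *)

Hypothesis al2 : alpha <= 2^-1.

(** The increment is minimal on a child [Q0], of mass at least alpha |Q|. The affine bound of
    [dual_certificate], lowered on [Q0] to the value of g there, is integrated. *)
Lemma integral_expR_cube_diff n Q : D n Q ->
  \int[P]_(x in Q) expR (cube_diff n x - (cube_diff n x) ^+ 2 / (4 * alpha))
  <= fine (P Q).
Proof.
move=> DQ; have mQ := cube_measurable n Q DQ; set X := cube_diff n.
have cX : cubewise n.+1 X := cube_diff_cubewise n.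
have [x0 Qx0 Xmin] := cubewise_argmin n.+1 X Q (D_inhabited n Q DQ) cX.
have PQ : 0 < fine (P Q).
  rewrite fine_gt0 // (P_cube_gt0 n) //=.
  by rewrite (le_lt_trans _ (ltry 1)) // probability_le1.
have IX : P.-integrable Q (EFin \o X) by exact: (cubewise_integrable n.+1).
have X0 : X x0 <= 0.
  have : \int[P]_(x in Q) X x0 <= \int[P]_(x in Q) X x.
    by apply: le_Rintegral => //; exact: finite_measure_integrable_cst.
  by rewrite integral_cube_diff // Rintegral_cst // pmulr_lle0.
pose g (x : R) := expR (x - x ^+ 2 / (4 * alpha)).
have [t tE] : exists t, t = - X x0 by exists (- X x0).
have t0 : 0 <= t by rewrite tE oppr_ge0.
have [mu [la [gle cert]]] : exists mu la,
    (forall x, - t <= x -> g x <= mu + la * x) /\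
    mu - alpha * (mu - la * t - g (- t)) <= 1.
  exact: dual_certificate.
(* The gap at - t between the affine bound and g. *)
pose nu := mu - la * t - g (- t).
have nu0 : 0 <= nu by have := gle (- t) (lexx _); rewrite /nu; lra.
pose Q0 := cube n.+1 x0.
have mQ0 : measurable Q0 by apply: (cube_measurable n.+1); exact: D_cube.
have Q0Q : Q0 `<=` Q by have [] := D_children n Q x0 DQ Qx0.
have cI : cubewise n.+1 (\1_Q0 : T -> R).
  move=> x y xy; rewrite !indicE; congr (_%:R); congr nat_of_bool.
  apply/idP/idP => /set_mem h; apply/mem_set; rewrite /Q0 /=.
    by rewrite -(cube_eq n.+1 x0 x).
  by rewrite -(cube_eq n.+1 x0 y) // (cube_eq n.+1 x y xy); exact: cube_refl.
have II : P.-integrable Q (EFin \o (\1_Q0 : T -> R)) by exact: (cubewise_integrable n.+1).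
have IB : \int[P]_(x in Q) \1_Q0 x = fine (P Q0).
  rewrite /Rintegral integral_indic //; congr (fine (P _)).
  by apply/setIidPl.
have PQ0 : alpha * fine (P Q) <= fine (P Q0).
  have := Hh n Q Q0 DQ (D_children n Q x0 DQ Qx0).
  rewrite -lee_fin EFinM !fineK //; exact: fin_num_measure.
have IlX : P.-integrable Q (EFin \o (fun x => la * X x)).
  apply: (cubewise_integrable n.+1) => //.
  exact: (cubewise_comp n.+1 (fun r => la * r)).
have InI : P.-integrable Q (EFin \o (fun x => nu * (\1_Q0 x : R))).
  apply: (cubewise_integrable n.+1) => //.
  exact: (cubewise_comp n.+1 (fun r => nu * r)).
have Imu : P.-integrable Q (EFin \o cst mu) by exact: finite_measure_integrable_cst.
have ImX : P.-integrable Q (EFin \o (fun x => mu + la * X x)).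
  apply: (cubewise_integrable n.+1) => //.
  exact: (cubewise_comp n.+1 (fun r => mu + la * r)).
have : \int[P]_(x in Q) g (X x) <=
       \int[P]_(x in Q) ((mu + la * X x) - nu * \1_Q0 x).
  apply: le_Rintegral => //.
  - apply: (cubewise_integrable n.+1) => //.
    exact: (cubewise_comp n.+1 g).
  - apply: (cubewise_integrable n.+1) => //.
    exact: (cubewise_comp2 n.+1 (fun r s => (mu + la * r) - nu * s)).
  - move=> x Qx; rewrite indicE; case: (boolP (x \in Q0)) => /= [/set_mem xQ0|_].
      have -> : X x = X x0 by apply/esym/cX.
      by rewrite mulr1 /nu tE opprK; lra.
    by rewrite mulr0 subr0; apply: gle; rewrite tE opprK; exact: Xmin.
rewrite RintegralB // RintegralD // !RintegralZl // IB integral_cube_diff //.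
rewrite Rintegral_cst // => /le_trans; apply.
(* The linear term has integral zero, which leaves mu |Q| - nu |Q0|. As nu >= 0, this is at most (mu
   - alpha nu) |Q|. *)
have := ler_wpM2l nu0 PQ0; have := ler_wpM2r (ltW PQ) cert.
rewrite -/nu; clearbody nu. lra.
Qed.

(** * The exponential supermartingale *)

Definition sq_partial n x := \sum_(k < n) cube_diff k x ^+ 2.

Definition exp_process n x := expR (cube_avg n x - sq_partial n x / (4 * alpha)).

Lemma exp_process_cubewise n : cubewise n (exp_process n).
Proof.
move=> x y xy; rewrite /exp_process /sq_partial (cube_avg_cubewise n x y xy).
rewrite (eq_bigr (fun k : 'I_n => cube_diff k y ^+ 2)) // => k _.
(* [cube_diff k] lives on generation k + 1, and k < n. *)
rewrite (cube_diff_cubewise k x y) //; exact: (cube_subset k.+1 n).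
Qed.

Lemma exp_processS n x : exp_process n.+1 x =
  exp_process n x * expR (cube_diff n x - cube_diff n x ^+ 2 / (4 * alpha)).
Proof.
rewrite /exp_process /sq_partial big_ord_recr /= -expRD; congr expR.
rewrite /cube_diff; ring.
Qed.

(** On a cube of generation n, [exp_process n] is constant and factors out, so the one-step estimate
    applies cube by cube. *)
Lemma integral_exp_process n :
  (\int[P]_x (exp_process n x)%:E <= (expR (expect P f))%:E)%E.
Proof.
elim: n => [|n IH].
  rewrite (eq_integral (cst (expR (expect P f))%:E)); last first.
    move=> x _; rewrite /exp_process /sq_partial big_ord0 mul0r subr0.
    by rewrite /cube_avg cube0.
  by rewrite (integral_cst P measurableT) /= probability_setT mule1.
apply: le_trans IH; apply: (le_integral_cubes n).
- exact: cubewise_measurable (exp_process_cubewise n.+1).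
- exact: cubewise_measurable (exp_process_cubewise n).
move=> Q DQ; have mQ := cube_measurable n Q DQ.
have fin m : (\int[P]_(x in Q) (exp_process m x)%:E)%E \is a fin_num.
  apply: integrable_fin_num => //.
  by apply: (cubewise_integrable m) => //; exact: exp_process_cubewise.
rewrite -[leLHS]fineK // -[leRHS]fineK // lee_fin.
have [x0 Qx0] := D_inhabited n Q DQ.
have EQ x : x \in Q -> exp_process n x = exp_process n x0.
  by move=> /set_mem Qx; apply: exp_process_cubewise; rewrite (cubeE n Q).
suff : \int[P]_(x in Q) exp_process n.+1 x <= \int[P]_(x in Q) exp_process n x.
  by [].
have -> : \int[P]_(x in Q) exp_process n x = exp_process n x0 * fine (P Q).
  by rewrite -Rintegral_cst //; apply: eq_Rintegral.
have -> : \int[P]_(x in Q) exp_process n.+1 x = \int[P]_(x in Q)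
    (exp_process n x0 * expR (cube_diff n x - cube_diff n x ^+ 2 / (4 * alpha))).
  by apply: eq_Rintegral => x Qx; rewrite exp_processS EQ.
rewrite RintegralZl //; last first.
  apply: (cubewise_integrable n.+1) => //.
  apply: (cubewise_comp n.+1 (fun r => expR (r - r ^+ 2 / (4 * alpha)))).
  exact: cube_diff_cubewise.
by rewrite ler_pM2l ?expR_gt0 //; exact: integral_expR_cube_diff.
Qed.

(** A cubewise [h] close to [f] equals a constant c on each cube, and replacing c by the average of
    [f] at most doubles the L^1 error. *)
Lemma cube_avg_L1 (e : R) : 0 < e ->
  exists n, (\int[P]_x `|f x - cube_avg n x|%:E <= e%:E)%E.
Proof.
move=> e0; have e2 : 0 < e / 2 by rewrite divr_gt0.
have [n [h hn ih]] := approximable_integrable f intf _ e2; exists n.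
have mh := cubewise_measurable n h hn.
have ma := cubewise_measurable n _ (cube_avg_cubewise n).
have mfh : measurable_fun setT (fun x => `|f x - h x|).
  by apply/measurable_EFinP; exact: measurable_norm_sub.
have mfa : measurable_fun setT (fun x => `|f x - cube_avg n x|).
  by apply/measurable_EFinP; exact: measurable_norm_sub.
apply: (@le_trans _ _ (\int[P]_x (2 * `|f x - h x|)%:E)%E); last first.
  under eq_integral do rewrite EFinM.
  rewrite ge0_integralZl //; last exact/measurable_EFinP.
  have -> : e%:E = (2%:E * (e / 2)%:E)%E by rewrite -EFinM mulrC divfK.
  by rewrite lee_pmul2l.
apply: (le_integral_cubes n) => //; first exact: measurable_funM.
move=> Q DQ; have mQ := cube_measurable n Q DQ.
have [x0 Qx0] := D_inhabited n Q DQ; set c := h x0.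
have hQ x : Q x -> h x = c by move=> Qx; apply: hn; rewrite (cubeE n Q).
have iN (b : R) : P.-integrable Q (EFin \o (fun x => f x - b)).
  apply: eq_integrable (integrableB mQ (intfS _ mQ) (finite_measure_integrable_cst P b mQ)) => //.
have iA (b : R) : P.-integrable Q (EFin \o (fun x => `|f x - b|)).
  by have := integrable_abse (iN b).
have E1 : (\int[P]_(x in Q) `|f x - cube_avg n x|%:E =
           (\int[P]_(x in Q) `|f x - avg P f Q|)%:E)%E.
  rewrite fineK; last by apply: integrable_fin_num => //; exact: iA.
  by apply: eq_integral => x /set_mem Qx; rewrite /cube_avg (cubeE n Q).
have E2 : (\int[P]_(x in Q) (2 * `|f x - h x|)%:E =
           (2 * \int[P]_(x in Q) `|f x - c|)%:E)%E.
  rewrite -RintegralZl // fineK; last by apply: integrable_fin_num => //; exact: (integrableZl mQ 2 (iA c)).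
  by apply: eq_integral => x /set_mem Qx; rewrite hQ.
rewrite E1 E2 lee_fin.
(* The left side is the absolute value of the integral of f - c over [Q]. *)
have key : `|c - avg P f Q| * fine (P Q) <= \int[P]_(x in Q) `|f x - c|.
  apply: le_trans (le_normr_Rintegral mQ (iN c)).
  rewrite RintegralB //; last 2 first.
  - exact: intfS.
  - exact: finite_measure_integrable_cst.
  rewrite Rintegral_cst // -(avgM n) // -mulrBl normrM distrC.
  by rewrite [X in _ <= _ * X]ger0_norm // fine_ge0.
have : \int[P]_(x in Q) `|f x - avg P f Q| <=
       \int[P]_(x in Q) (`|f x - c| + `|c - avg P f Q|).
  apply: le_Rintegral => //.
    apply: eq_integrable (integrableD mQ (iA c) (finite_measure_integrable_cst P `|c - avg P f Q| mQ)) => //.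
  by move=> x _; rewrite ler_distD.
rewrite RintegralD // ?Rintegral_cst //; last exact: finite_measure_integrable_cst.
by move: key; lra.
Qed.

(** * The square function and the passage to the limit *)

Lemma DeltaE n x : Delta P D n (cube n x) f x = cube_diff n x.
Proof.
rewrite /Delta indicE (mem_set (cube_refl n x)) mulr1; congr (_ - _).
rewrite -(@fsbig_widen _ _ _ _ [set cube n.+1 x]).
- by rewrite fsbig_set1 indicE (mem_set (cube_refl n.+1 x)) mulr1.
- by move=> _ ->; apply: D_children; [exact: D_cube|exact: cube_refl].
- move=> Q [[DQ _] nQ] /=; rewrite indicE memNset ?mulr0 // => Qx.
  by apply: nQ; rewrite /= (cubeE n.+1 Q x).
Qed.

Lemma sq_partial_le n x : ((sq_partial n x)%:E <= sqfun_sq P D f x)%E.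
Proof.
(* The pairs record the generation, so they stay distinct even when one set is a cube of several
   generations. *)
apply: esum_ge; exists ((fun k => (k, cube k x)) @` `I_n).
  split; first exact/finite_image/finite_II.
  by move=> _ [k _ <-]; exact: D_cube.
rewrite fsbig_image; last by move=> k l _ _ [].
rewrite -(fsbig_ord _ n (fun k => ((Delta P D k (cube k x) f x) ^+ 2)%:E)).
rewrite sumEFin lee_fin; under [leRHS]eq_bigr do rewrite DeltaE.
exact: lexx.
Qed.

Lemma integral_exp_le (M : R) : {ae P, forall x, (sqfun_sq P D f x <= M%:E)%E} ->
  (\int[P]_x (expR (f x - (sqfun P D f x) ^+ 2 / (4 * alpha)))%:E
     <= (expR (expect P f))%:E)%E.
Proof.
(* The integral is a supremum over simple functions below the integrand; being bounded, each can
   absorb an L^1 error. *)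
move=> HM; rewrite ge0_integralTE; last by move=> x; rewrite lee_fin expR_ge0.
apply: ge_ereal_sup => _ [h hle <-].
rewrite -[sintegral _ _]/(sintegral P h).
have -> : sintegral P h = (\int[P]_x (h x)%:E)%E.
  by rewrite integral_nnsfun // patch_setT.
have [C C0 hC] : exists2 C, 0 < C & forall x, h x <= C.
  have [M0 [_ hM0]] := simple_bounded h.
  exists (`|M0| + 1); first by have := normr_ge0 M0; lra.
  move=> x; apply: (le_trans (ler_norm _)); apply: hM0 => //.
  by have := ler_norm M0; lra.
apply/lee_addgt0Pr => e e0.
have [n hn] := cube_avg_L1 (e / C) (divr_gt0 e0 C0).
have mE : measurable_fun setT (exp_process n).
  exact: cubewise_measurable (exp_process_cubewise n).
have mN : measurable_fun setT (fun x => `|f x - cube_avg n x|%:E).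
  apply: measurable_norm_sub => //.
  exact: cubewise_measurable (cube_avg_cubewise n).
apply: (@le_trans _ _ (\int[P]_x ((exp_process n x)%:E + C%:E * `|f x - cube_avg n x|%:E))%E).
  apply: ae_ge0_le_integral => //.
  - by move=> x _; rewrite lee_fin.
  - by apply/measurable_EFinP.
  - by move=> x _; rewrite -EFinM -EFinD lee_fin addr_ge0 ?expR_ge0 // mulr_ge0 // ltW.
  - by apply: emeasurable_funD; [exact/measurable_EFinP|exact: measurable_funeM].
  apply: filterS HM => x xM _; rewrite -EFinM -EFinD lee_fin.
  (* [fine] would turn an infinite sum into 0 inside [sqfun], so finiteness comes before the
     comparison with partial sums. *)
  have sfin : sqfun_sq P D f x \is a fin_num.
    rewrite ge0_fin_numE ?(le_lt_trans xM) ?ltry //.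
    by apply: le_trans (sq_partial_le 0 x); rewrite /sq_partial big_ord0.
  have sle : sq_partial n x <= sqfun P D f x ^+ 2.
    have := sq_partial_le n x; rewrite -{1}(fineK sfin) lee_fin => sle.
    rewrite /sqfun sqr_sqrtr // (le_trans _ sle) //.
    by apply: sumr_ge0 => k _; exact: sqr_ge0.
  have hz : h x <= expR (f x - sq_partial n x / (4 * alpha)).
    have := hle x; rewrite lee_fin => /le_trans; apply.
    rewrite ler_expR lerD2l lerN2 ler_wpM2r // invr_ge0 mulr_ge0 // ltW //.
  have h0 : 0 <= h x by [].
  have hCx := hC x.
  set w := exp_process n x.
  have w0 : 0 <= w by exact: expR_ge0.
  (* From 1 - u <= exp (- u) with u = f x - f_n x. *)
  have hw : h x * (1 - (f x - cube_avg n x)) <= w.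
    have E : w = expR (f x - sq_partial n x / (4 * alpha)) * expR (- (f x - cube_avg n x)).
      by rewrite /w /exp_process -expRD; congr expR; ring.
    rewrite E; apply: (le_trans (ler_wpM2l h0 (expR_ge1Dx (- (f x - cube_avg n x))))).
    by rewrite ler_wpM2r ?expR_ge0.
  (* It remains that h x <= w + h x * u <= w + C |u|. *)
  have := ler_norm (f x - cube_avg n x); move: (normr_ge0 (f x - cube_avg n x)).
  move: (f x - cube_avg n x) `|f x - cube_avg n x| hw => u v hw v0 uv.
  have := ler_wpM2l h0 uv; have := ler_wpM2r v0 hCx; lra.
rewrite ge0_integralD //; last 4 first.
- by move=> x _; rewrite lee_fin expR_ge0.
- by apply/measurable_EFinP.
- by move=> x _; rewrite -EFinM lee_fin mulr_ge0 // ltW.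
- exact: measurable_funeM.
rewrite ge0_integralZl //; last by rewrite lee_fin ltW.
apply: leeD; first exact: integral_exp_process.
have -> : e%:E = (C%:E * (e / C)%:E)%E by rewrite -EFinM mulrC divfK // gt_eqF.
by rewrite lee_pmul2l.
Qed.

End Filtration.

Theorem theorem2p1 (d : measure_display) (T : measurableType d) (R : realType)
  (P : probability T R) (F : nat -> set (set T)) (D : nat -> set (set T))
  (alpha : R) (f : T -> R) :
  atomic_filtration F D ->
  0 < alpha -> alpha <= 2^-1 ->
  homogeneous P D alpha ->
  P.-integrable setT (EFin \o f) ->
  (exists M : R, {ae P, forall x, (sqfun_sq P D f x <= M%:E)%E}) ->
  (\int[P]_x (expR (f x - (sqfun P D f x) ^+ 2 / (4 * alpha)))%:E
     <= (expR (expect P f))%:E)%E.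
Proof.
move=> HF al0 al2 Hh intf [M HM].
exact: (integral_exp_le P F D alpha HF al0 Hh f intf al2 M HM).
Qed.
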